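(* Let $(\mathcal{V},g)$ be a (possibly indefinite) scalar product space. Suppose that for every nonnull $X\in\mathcal{V}$ we are given a $g$-self-adjoint linear endomorphism $\mathcal{K}_X\colon\mathcal{V}\to\mathcal{V}$ such that the family is compatible, i.e. $g(\mathcal{K}_XY,Y)=g(\mathcal{K}_YX,X)$ for all nonnull $X,Y\in\mathcal{V}$, and such that $\mathcal{K}_XX=0$ for every nonnull $X\in\mathcal{V}$. Then there exists a unique algebraic curvature tensor $R$ on $(\mathcal{V},g)$ such that the $\mathcal{K}_X$ are its Jacobi operators, i.e. $\mathcal{J}_X=\mathcal{K}_X$ for all nonnull $X\in\mathcal{V}$, where $\mathcal{J}_X$ is the Jacobi operator of $R$.
   Context: A scalar product space $(\mathcal{V},g)$ is a finite-dimensional real vector space $\mathcal{V}$ with a nondegenerate symmetric bilinear form $g$, not necessarily positive definite. A vector $X\in\mathcal{V}$ is nonnull if $g(X,X)\neq 0$. An algebraic curvature tensor on $(\mathcal{V},g)$ is a multilinear map $R\colon\mathcal{V}^4\to\mathbb{R}$ such that for all $X,Y,Z,W\in\mathcal{V}$: $R(X,Y,Z,W)=-R(Y,X,Z,W)$; $R(X,Y,Z,W)=-R(X,Y,W,Z)$; $R(X,Y,Z,W)+R(Y,Z,X,W)+R(Z,X,Y,W)=0$; and (as a consequence of these) $R(X,Y,Z,W)=R(Z,W,X,Y)$. The associated curvature operator $\mathcal{R}$ is defined by $g(\mathcal{R}(X,Y)Z,W)=R(X,Y,Z,W)$. The Jacobi operator of $R$ at $X\in\mathcal{V}$ is the linear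 map $\mathcal{J}_X\colon\mathcal{V}\to\mathcal{V}$, $\mathcal{J}_X(Y)=\mathcal{R}(Y,X)X$; equivalently $g(\mathcal{J}_XY,W)=R(Y,X,X,W)$ for all $Y,W\in\mathcal{V}$. *)

(* Defs.v *)
From HB Require Import structures.
From mathcomp Require Import all_boot all_order all_algebra.
From mathcomp Require Import boolp classical_sets reals.
From mathcomp Require Import lra.

Set Implicit Arguments.
Unset Strict Implicit.
Unset Printing Implicit Defensive.
Import GRing.Theory.
Local Open Scope ring_scope.
Local Open Scope classical_set_scope.

(* A scalar product space is a V : vectType R (finite-dimensional) over the reals
   R : realType, together with g : {symmetric V} such that nondegenerate g. *)

Definition nonnull (R : realType) (V : vectType R) (g : {symmetric V}) (X : V) : bool :=
  g X X != 0.

Definition self_adjoint (R : realType) (V : vectType R) (g : {symmetric V})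
    (f : 'End(V)) : Prop :=
  forall Y Z : V, g (f Y) Z = g Y (f Z).

(* The pair symmetry T X Y Z W = T Z W X Y is not a field: it follows from the
   others, see curvature_tensor_pair_sym below. *)
Record algebraic_curvature_tensor (R : realType) (V : vectType R)
    (T : V -> V -> V -> V -> R) : Prop := AlgebraicCurvatureTensor {
  act_linear1 : forall Y Z W : V, scalar (fun X => T X Y Z W);
  act_linear2 : forall X Z W : V, scalar (fun Y => T X Y Z W);
  act_linear3 : forall X Y W : V, scalar (fun Z => T X Y Z W);
  act_linear4 : forall X Y Z : V, scalar (fun W => T X Y Z W);
  act_skew12 : forall X Y Z W : V, T X Y Z W = - T Y X Z W;
  act_skew34 : forall X Y Z W : V, T X Y Z W = - T X Y W Z;
  act_bianchi : forall X Y Z W : V, T X Y Z W + T Y Z X W + T Z X Y W = 0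
}.

(* curvature_operator g T X Y Z is the vector v with g v W = T X Y Z W for all W;
   it exists and is unique when g is nondegenerate and T is linear in its last
   argument (curvature_operatorE, curvature_operator_unique), and is 0 by
   convention if no such vector exists. *)
Definition curvature_operator (R : realType) (V : vectType R) (g : {symmetric V})
    (T : V -> V -> V -> V -> R) (X Y Z : V) : V :=
  xget 0 [set v : V | forall W : V, g v W = T X Y Z W].

Definition jacobi_operator (R : realType) (V : vectType R) (g : {symmetric V})
    (T : V -> V -> V -> V -> R) (X : V) : V -> V :=
  fun Y => curvature_operator g T Y X X.

Lemma nondegenerate_inj (R : realType) (V : vectType R) (g : {symmetric V})
    (u v : V) : nondegenerate g -> (forall W, g u W = g v W) -> u = v.
Proof.
move=> /eqP nd guv; apply/eqP; rewrite -subr_eq0 -memv0 -nd.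
apply/mem_orthovP => W _.
by rewrite linearBl /= guv subrr.
Qed.

Lemma nondegenerate_riesz (R : realType) (V : vectType R) (g : {symmetric V})
    (f : V -> R) : nondegenerate g -> scalar f ->
  exists v : V, forall W, g v W = f W.
Proof.
move=> nd lf; pose e := vbasis {:V}.
pose h (v : V) : 'rV[R]_(\dim {:V}) := \row_i g v e`_i.
have hlin : linear h.
  by move=> a u v; apply/rowP => i; rewrite !mxE linearPl.
pose H := GRing.isLinear.Build _ _ _ _ h hlin.
pose hL : {linear V -> 'rV[R]_(\dim {:V})} := HB.pack h H.
pose F := linfun hL.
pose fL : {linear V -> R^o} :=
  HB.pack f (GRing.isLinear.Build R V R^o *:%R f lf).
have ext (p q : {linear V -> R^o}) : (forall i : 'I_(\dim {:V}), p e`_i = q e`_i) -> p =1 q.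
  move=> pq W; rewrite (coord_vbasis (memvf W)) !linear_sum.
  by apply: eq_bigr => i _; rewrite !linearZ pq.
pose gv v : V -> R := fun W => g v W.
have gvl v : linear (gv v : V -> R^o) by move=> a u w; exact: linearPr.
pose gL (v : V) : {linear V -> R^o} :=
  HB.pack (gv v) (GRing.isLinear.Build R V R^o *:%R (gv v) (gvl v)).
have Finj : lker F == 0%VS.
  apply/lker0P => u v; rewrite !lfunE /= => huv.
  apply: (nondegenerate_inj nd) => W; apply: (ext (gL u) (gL v)) => i /=.
  by move/rowP: huv => /(_ i); rewrite !mxE.
have Fsurj : limg F = fullv.
  apply/eqP; rewrite eqEdim subvf /=.
  by rewrite limg_dim_eq ?(eqP Finj) ?capv0 // !dimvf /dim /= mul1n.
have : \row_i f e`_i \in limg F by rewrite Fsurj memvf.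
case/memv_imgP => v _; rewrite lfunE /= => hv; exists v => W.
apply: (ext (gL v) fL) => i /=.
by move/rowP: hv => /(_ i); rewrite !mxE.
Qed.

Lemma curvature_operatorE (R : realType) (V : vectType R) (g : {symmetric V})
    (T : V -> V -> V -> V -> R) (X Y Z W : V) :
  nondegenerate g -> scalar (fun W => T X Y Z W) ->
  g (curvature_operator g T X Y Z) W = T X Y Z W.
Proof.
move=> nd lT; have [v hv] := nondegenerate_riesz nd lT.
exact: (@xgetPex _ 0 [set v : V | forall W : V, g v W = T X Y Z W]
  (ex_intro _ v hv) W).
Qed.

Lemma curvature_operator_unique (R : realType) (V : vectType R)
    (g : {symmetric V}) (T : V -> V -> V -> V -> R) (X Y Z v : V) :
  nondegenerate g -> (forall W, g v W = T X Y Z W) ->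
  curvature_operator g T X Y Z = v.
Proof.
move=> nd hv; apply: (nondegenerate_inj nd) => W; rewrite hv.
exact: (@xgetPex _ 0 [set v : V | forall W : V, g v W = T X Y Z W]
  (ex_intro _ v hv) W).
Qed.

Lemma jacobi_operatorE (R : realType) (V : vectType R) (g : {symmetric V})
    (T : V -> V -> V -> V -> R) (X Y W : V) :
  nondegenerate g -> algebraic_curvature_tensor T ->
  g (jacobi_operator g T X Y) W = T Y X X W.
Proof. by move=> nd hT; exact: curvature_operatorE nd (act_linear4 hT _ _ _). Qed.

Lemma jacobi_operator_linear (R : realType) (V : vectType R) (g : {symmetric V})
    (T : V -> V -> V -> V -> R) (X : V) :
  nondegenerate g -> algebraic_curvature_tensor T ->
  linear (jacobi_operator g T X).
Proof.
move=> nd hT a u v; apply: (nondegenerate_inj nd) => W.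
by rewrite linearPl /= !jacobi_operatorE // (act_linear1 hT).
Qed.

Lemma curvature_tensor_pair_sym (R : realType) (V : vectType R)
    (T : V -> V -> V -> V -> R) (X Y Z W : V) :
  algebraic_curvature_tensor T -> T X Y Z W = T Z W X Y.
Proof.
move=> [_ _ _ _ s12 s34 bi].
have := bi X Y Z W; have := bi Y Z W X; have := bi Z W X Y; have := bi W X Y Z.
have := s34 Y Z W X; have := s34 Z W Y X; have := s34 X Y W Z.
have := s34 W X Z Y; have := s12 Z X Y W; have := s34 X Z Y W.
have := s12 W Y Z X; have := s34 Y W Z X.
lra.
Qed.

(* Main.v *)
(** For every vector Z <> 0 there is a U such that U, Z ± U and Z ± 2U are
    nonnull, so the parallelogram law (resp. its cubic analogue) shows that a
    quadratic or cubic form vanishing on nonnull vectors vanishes identically.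
    Compatibility says that Q(X, Y) = g (K_X Y) Y is symmetric, hence quadratic
    in either argument, as long as both arguments are nonnull; the parallelogram
    law extends it to all vectors, and its double polarization S satisfies
    S(X, X; X, W) = 0.  The tensor is then recovered from the classical formula
    T(X, Y, Z, W) = 2/3 (S(Y, Z; X, W) - S(X, Z; Y, W)). *)
Require Import Defs.
From mathcomp Require Import all_boot all_order all_algebra.
From mathcomp Require Import boolp reals ring lra.
Set Implicit Arguments.
Unset Strict Implicit.
Unset Printing Implicit Defensive.
Import GRing.Theory.
Local Open Scope ring_scope.

Lemma scalar_add (R : realType) (V : vectType R) (f : V -> R) (u v : V) :
  scalar f -> f (u + v) = f u + f v.
Proof. by move=> lf; rewrite -[u in LHS]scale1r lf mul1r. Qed.

Lemma scalar_scale (R : realType) (V : vectType R) (f : V -> R) (a : R) (u : V) :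
  scalar f -> f (a *: u) = a * f u.
Proof.
move=> lf; have f0 : f 0 = 0.
  by have := scalar_add 0 0 lf; rewrite addr0 => ?; lra.
by rewrite -[a *: u]addr0 lf f0 addr0.
Qed.

Lemma scalar_opp (R : realType) (V : vectType R) (f : V -> R) (u : V) :
  scalar f -> f (- u) = - f u.
Proof. by move=> lf; rewrite -scaleN1r scalar_scale // mulN1r. Qed.

(** * Nonnull vectors as a test set for polynomial identities *)

Section NonnullVectors.
Variables (R : realType) (V : vectType R) (g : {symmetric V}).
Hypothesis g_nondeg : nondegenerate g.

Lemma form_sym (u v : V) : g u v = g v u.
Proof. by rewrite hermC /= expr0 mul1r. Qed.

(** For nonnull [Z] a multiple of [Z] works. For null [Z], nondegeneracy gives a nonnull [W] with
    [g Z W != 0]. The norm of [Z + t *: W] is then [t] times [2 * g Z W + t * g W W], which has a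
    single nonzero root, and a suitable scaling of [W] avoids it. *)
Lemma nonnull_shift (Z : V) : Z != 0 ->
  exists U : V, nonnull g U /\
    {in [:: 1; -1; 2; -2], forall e : R, nonnull g (Z + e *: U)}.
Proof.
move=> Z0.
have expand (a b : R) (x y : V) : g (a *: x + b *: y) (a *: x + b *: y) =
    a ^+ 2 * g x x + 2 * a * b * g x y + b ^+ 2 * g y y.
  rewrite !linearDl !linearDr /= !linearZl_LR !linearZr_LR /=.
  by rewrite (form_sym y x); ring.
have scale_nonnull a x : g x x != 0 -> a != 0 -> g (a *: x) (a *: x) != 0.
  move=> xx a0; rewrite linearZl_LR /= linearZr_LR /=.
  by rewrite !mulf_neq0.
rewrite /nonnull; case: (eqVneq (g Z Z) 0) => [Znull|Znn]; last first.
  (* The factors [1 + e * 3] are 4, -2, 7 and -5, all nonzero. *)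
  exists (3 *: Z); split=> [|e he].
    by apply: scale_nonnull => //; apply/eqP => ?; lra.
  have -> : Z + e *: (3 *: Z) = (1 + e * 3) *: Z.
    by rewrite scalerDl scale1r scalerA.
  apply: scale_nonnull => //.
  by move: he; rewrite !inE => /or4P[] /eqP ->; apply/eqP => ?; lra.
have [W0 ZW0] : exists W, g Z W != 0.
  apply: contrapT => noW; move/eqP: Z0; apply.
  apply: (nondegenerate_inj g_nondeg) => W; rewrite linear0l.
  by apply/eqP; apply: contrapT => /negP ?; apply: noW; exists W.
have [W ZW WW] : exists2 W, g Z W != 0 & g W W != 0.
  case: (eqVneq (g W0 W0) 0) => WW0; last by exists W0.
  (* If [W0] is null, [Z + W0] has norm [2 * g Z W0] and, as [Z] is null, the same product with [Z]
     as [W0]. *)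
  have e := expand 1 1 Z W0; rewrite !scale1r Znull WW0 in e.
  exists (Z + W0); first by rewrite linearDr /= Znull add0r.
  by rewrite e; apply/eqP => h; move/eqP: ZW0; apply; lra.
have q t : t != 0 -> g (Z + t *: W) (Z + t *: W) = 0 ->
    t * g W W = - 2 * g Z W.
  move=> t0; have := expand 1 t Z W; rewrite scale1r Znull => -> h.
  by apply: (mulfI t0); lra.
have good t : t != 0 ->
    {in [:: 1; -1; 2; -2], forall e, e * t * g W W != - 2 * g Z W} ->
    exists U : V, g U U != 0 /\
      {in [:: 1; -1; 2; -2], forall e : R, g (Z + e *: U) (Z + e *: U) != 0}.
  move=> t0 ht; exists (t *: W); split=> [|e he]; first exact: scale_nonnull.
  rewrite scalerA; apply/eqP => /q h; move/eqP: (ht _ he); apply; apply: h.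
  rewrite mulf_neq0 //; move: he; rewrite !inE.
  by case/or4P => /eqP ->; apply/eqP => ?; lra.
(* U = t W fails only if |2 g Z W / g W W| is t or 2t, so t = 1 or t = 3 works. *)
case: (pselect {in [:: 1; -1; 2; -2],
    forall e, e * 1 * g W W != - 2 * g Z W}) => [/good|bad].
  by apply; exact: oner_neq0.
apply: (good 3); first by apply/eqP => ?; lra.
move=> e he; apply/eqP => h3; apply: bad => f hf; apply/eqP => h1.
have : g W W * (3 * e - f) = 0 by lra.
move/eqP; rewrite mulf_eq0 (negbTE WW) /= => /eqP.
move: he hf; rewrite !inE.
by case/or4P => /eqP ->; case/or4P => /eqP -> ?; lra.
Qed.

Lemma nonnull_shift_pm (Z : V) : Z != 0 ->
  exists U : V, [/\ nonnull g U, nonnull g (Z + U) & nonnull g (Z - U)].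
Proof.
move=> /nonnull_shift[U [hU h]]; exists U; split=> //.
  by have := h 1; rewrite scale1r; apply; rewrite !inE eqxx.
by have := h (-1); rewrite scaleN1r; apply; rewrite !inE eqxx ?orbT.
Qed.

(** The parallelogram law settles the diagonal and polarization the rest. An identity that is
    symmetric bilinear in two arguments can thus be checked with both equal to one nonnull
    vector. *)
Lemma symmetric_form_eq0 (b : V -> V -> R) :
  (forall W, scalar (b ^~ W)) -> (forall Y W, b Y W = b W Y) ->
  (forall Y, nonnull g Y -> b Y Y = 0) -> forall Y W, b Y W = 0.
Proof.
move=> bl bs b0.
have bD x y z : b (x + y) z = b x z + b y z by exact: (scalar_add _ _ (bl z)).
have bN x z : b (- x) z = - b x z by exact: (scalar_opp _ (bl z)).
have Dr x y z : b z (x + y) = b z x + b z y by rewrite !(bs z) bD.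
have Nr x z : b z (- x) = - b z x by rewrite !(bs z) bN.
have diag Y : b Y Y = 0.
  case: (eqVneq Y 0) => [->|/nonnull_shift_pm[U [hU hp hm]]].
    by have := bD 0 0 0; rewrite addr0; lra.
  move: (b0 _ hU) (b0 _ hp) (b0 _ hm).
  rewrite !bD !bN !Dr !Nr (bs U Y); lra.
move=> Y W; have := diag (Y + W).
by rewrite bD !Dr !diag (bs W Y); lra.
Qed.

(** Along [X + e *: U] the form is a polynomial p in [e] of degree at most 3, and 6 p(0) = 4 (p(1) +
    p(-1)) - (p(2) + p(-2)). *)
Lemma cubic_form_eq0 (c : V -> V -> V -> R) :
  (forall Y Z, scalar (fun X => c X Y Z)) ->
  (forall X Z, scalar (fun Y => c X Y Z)) ->
  (forall X Y, scalar (c X Y)) ->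
  (forall X, nonnull g X -> c X X X = 0) -> forall X, c X X X = 0.
Proof.
move=> l1 l2 l3 c0 X.
have D1 a x y z w : c (x + a *: y) z w = c x z w + a * c y z w.
  by rewrite addrC l1 addrC.
have D2 a x y z w : c z (x + a *: y) w = c z x w + a * c z y w.
  by rewrite addrC l2 addrC.
have D3 a x y z w : c z w (x + a *: y) = c z w x + a * c z w y.
  by rewrite addrC l3 addrC.
case: (eqVneq X 0) => [->|/nonnull_shift[U [_ h]]].
  by rewrite -[X in c X _ _](scale0r 0) (scalar_scale _ _ (l1 _ _)) mul0r.
have {}h e : e \in [:: 1; -1; 2; -2] ->
    c (X + e *: U) (X + e *: U) (X + e *: U) = 0 by move=> he; apply/c0/h.
have h1 := h 1 ltac:(by rewrite !inE eqxx).
have h2 := h (-1) ltac:(by rewrite !inE eqxx ?orbT).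
have h3 := h 2 ltac:(by rewrite !inE eqxx ?orbT).
have h4 := h (-2) ltac:(by rewrite !inE eqxx ?orbT).
by move: h1 h2 h3 h4; rewrite !D1 !D2 !D3; lra.
Qed.

End NonnullVectors.

(** * Curvature tensors and their symmetric counterparts *)

Section SymmetricCurvature.
Variables (R : realType) (V : vectType R).

(** Inverse of the passage from a curvature tensor [T] to the polarized Jacobi form S(X, Y; Z, W) =
    1/2 (T(Z, X, Y, W) + T(Z, Y, X, W)); the Bianchi identity produces the factor 2/3. *)
Definition curvature_of_symmetric (S : V -> V -> V -> V -> R) (X Y Z W : V) : R :=
  2 / 3 * (S Y Z X W - S X Z Y W).

Section FromSymmetric.
Variable S : V -> V -> V -> V -> R.
Hypothesis S_linear1 : forall Y Z W, scalar (fun X => S X Y Z W).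
Hypothesis S_sym12 : forall X Y Z W, S X Y Z W = S Y X Z W.
Hypothesis S_sym34 : forall X Y Z W, S X Y Z W = S X Y W Z.
Hypothesis S_pair : forall X Y Z W, S X Y Z W = S Z W X Y.
Hypothesis S_diag : forall X W, S X X X W = 0.

Let S_linear2 X Z W : scalar (fun Y => S X Y Z W).
Proof. by move=> a u v; rewrite !(S_sym12 X) S_linear1. Qed.

Let S_linear3 X Y W : scalar (fun Z => S X Y Z W).
Proof. by move=> a u v; rewrite !(S_pair X) S_linear1. Qed.

Let S_linear4 X Y Z : scalar (fun W => S X Y Z W).
Proof. by move=> a u v; rewrite !(S_pair X) S_linear2. Qed.

(** Exchanging [X] and [Y] swaps the two terms, and so does exchanging [Z] and [W], by pair
    symmetry. In the cyclic sum the terms cancel by symmetry in the first two arguments. *)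
Lemma curvature_of_symmetricP :
  algebraic_curvature_tensor (curvature_of_symmetric S).
Proof.
split; rewrite /curvature_of_symmetric => X Y Z.
- by move=> a u v; rewrite S_linear1 S_linear3; ring.
- by move=> a u v; rewrite S_linear1 S_linear3; ring.
- by move=> a u v; rewrite !S_linear2; ring.
- by move=> a u v; rewrite !S_linear4; ring.
- by move=> W; ring.
- move=> W; rewrite (S_pair Y Z) (S_pair X Z) (S_sym12 X W) (S_sym34 _ _ Y Z).
  by rewrite !(S_sym12 _ W) !(S_sym34 W _ _ Z); ring.
- by move=> W; rewrite (S_sym12 Z X) (S_sym12 Y X) (S_sym12 Z Y); ring.
Qed.

Lemma curvature_of_symmetricE (X Y W : V) :
  curvature_of_symmetric S Y X X W = S X X Y W.
Proof.
have D1 a x y z w t : S (x + a *: y) z w t = S x z w t + a * S y z w t.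
  by rewrite addrC S_linear1 addrC.
have D2 a x y z w t : S z (x + a *: y) w t = S z x w t + a * S z y w t.
  by rewrite addrC S_linear2 addrC.
have D3 a x y z w t : S z w (x + a *: y) t = S z w x t + a * S z w y t.
  by rewrite addrC S_linear3 addrC.
(* The difference of the two expansions isolates S(X, X; Y, W) + 2 S(X, Y; X, W) = 0, so the bracket
   in the definition is 3/2 S(X, X; Y, W). *)
move: (S_diag (X + 1 *: Y) W) (S_diag (X + (-1) *: Y) W).
rewrite /curvature_of_symmetric !D1 !D2 !D3 !S_diag !(S_sym12 Y X); lra.
Qed.

End FromSymmetric.

(** Polarizing the hypothesis makes the difference D of the two tensors skew in its middle
    arguments. Being also skew in the first two, D is invariant under cyclic shifts of the first
    three, and the Bianchi identity reads 3 D = 0. *)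
Lemma curvature_tensor_ext (T T' : V -> V -> V -> V -> R) :
  algebraic_curvature_tensor T -> algebraic_curvature_tensor T' ->
  (forall X Y W, T Y X X W = T' Y X X W) ->
  forall X Y Z W, T X Y Z W = T' X Y Z W.
Proof.
move=> hT hT' e.
have skew23 X Y Z W :
    T X Y Z W - T' X Y Z W = - (T X Z Y W - T' X Z Y W).
  have := e (Y + Z) X W.
  rewrite !(scalar_add Y Z (act_linear2 _ _ _ _)) //.
  by rewrite !(scalar_add Y Z (act_linear3 _ _ _ _)) // !e; lra.
move=> X Y Z W.
have := act_bianchi hT X Y Z W; have := act_bianchi hT' X Y Z W.
have := skew23 Y X Z W; have := skew23 X Y Z W.
have := act_skew12 hT Y X Z W; have := act_skew12 hT' Y X Z W.
have := act_skew12 hT Z X Y W; have := act_skew12 hT' Z X Y W.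
lra.
Qed.

End SymmetricCurvature.

(** * From the compatible family to its curvature tensor *)

Section JacobiFamily.
Variables (R : realType) (V : vectType R) (g : {symmetric V}).
Hypothesis g_nondeg : nondegenerate g.
Variable K : forall X : V, nonnull g X -> 'End(V).
Arguments K : clear implicits.
Hypothesis K_self_adjoint :
  forall (X : V) (hX : nonnull g X), self_adjoint g (K X hX).
Hypothesis K_compatible : forall (X Y : V) (hX : nonnull g X) (hY : nonnull g Y),
  g (K X hX Y) Y = g (K Y hY X) X.
Hypothesis K_diag : forall (X : V) (hX : nonnull g X), K X hX X = 0.

Lemma K_form_linear_l (X : V) (hX : nonnull g X) (Z : V) :
  scalar (fun Y => g (K X hX Y) Z).
Proof. by move=> a u v; rewrite linearP linearPl. Qed.

Lemma K_form_sym (X : V) (hX : nonnull g X) (Y Z : V) :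
  g (K X hX Y) Z = g (K X hX Z) Y.
Proof. by rewrite K_self_adjoint form_sym. Qed.

(** [f] stands in for [K] at an arbitrary, possibly null, [Z]. *)
Lemma K_extend (Z : V) : exists f : 'End(V), self_adjoint g f /\
  forall (Y : V) (hY : nonnull g Y), g (f Y) Y = g (K Y hY Z) Z.
Proof.
case: (eqVneq Z 0) => [->|/(nonnull_shift_pm g_nondeg)[U [hU hp hm]]].
  exists 0; split => [Y W|Y hY]; first by rewrite !lfunE /= linear0l linear0r.
  by rewrite !lfunE /= linear0l linear0r.
(* The parallelogram law for the quadratic form [g (K Y hY Z) Z] in [Z], transferred by
   compatibility to the operators at [Z + U], [Z - U] and [U]. *)
exists (2^-1 *: (K _ hp + K _ hm) - K _ hU).
have fE Y W : g ((2^-1 *: (K _ hp + K _ hm) - K _ hU) Y) W =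
    2^-1 * (g (K _ hp Y) W + g (K _ hm Y) W) - g (K _ hU Y) W.
  by rewrite !lfunE /= !lfunE /= !lfunE /= linearBl /= linearZl_LR /= linearDl.
split=> [Y W|Y hY].
  by rewrite fE (form_sym _ Y) fE !(K_form_sym _ Y).
rewrite fE !(K_compatible _ hY).
have D := fun x y z => scalar_add x y (K_form_linear_l hY z).
have N := fun x z => scalar_opp x (K_form_linear_l hY z).
have Dr x y z : g (K Y hY z) (x + y) = g (K Y hY z) x + g (K Y hY z) y.
  by rewrite linearDr.
have Nr x z : g (K Y hY z) (- x) = - g (K Y hY z) x by rewrite linearNr.
rewrite !D !N !Dr !Nr (K_form_sym hY U Z); lra.
Qed.

(** The operators [F X] are merely chosen, with no linearity in [X] at hand; so bilinearity in the
    first pair is visible only where the last two arguments are one nonnull vector. *)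
Lemma K_polarization : exists S : V -> V -> V -> V -> R,
  [/\ forall X X' Y W, S X X' Y W = S X' X Y W,
      forall X X' Y W, S X X' Y W = S X X' W Y,
      forall X X' W, scalar (fun Y => S X X' Y W) &
      forall (X X' Y : V) (hY : nonnull g Y), S X X' Y Y = g (K Y hY X) X'].
Proof.
have [F hF] := choice K_extend.
exists (fun X X' Y W =>
  2^-1 * (g (F (X + X') Y) W - g (F X Y) W - g (F X' Y) W)); split.
- by move=> X X' Y W; rewrite (addrC X X'); ring.
- have Fs X Y W : g (F X Y) W = g (F X W) Y by rewrite (hF X).1 form_sym.
  by move=> X X' Y W; rewrite !(Fs _ Y W).
- by move=> X X' W a u v; rewrite !linearP !linearPl /=; ring.
- move=> X X' Y hY; rewrite !((hF _).2 _ hY).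
  rewrite (scalar_add _ _ (K_form_linear_l _ _)) !(K_form_sym _ _ (X + X')).
  rewrite !(scalar_add _ _ (K_form_linear_l _ _)) (K_form_sym _ X' X); lra.
Qed.

Lemma K_curvature_tensor : exists T : V -> V -> V -> V -> R,
  algebraic_curvature_tensor T /\
  forall (X Y W : V) (hX : nonnull g X), T Y X X W = g (K X hX Y) W.
Proof.
have [S [s12 s34 l3 SK]] := K_polarization.
(* In this and the next two claims the defect [b] is symmetric bilinear, so it only has to vanish on
   nonnull diagonals, where [SK] expresses [S] through [K]. *)
have l1 X' Y W : scalar (fun X => S X X' Y W).
  move=> a u v; apply/eqP; rewrite -subr_eq0; apply/eqP.
  pose b Y W := S (a *: u + v) X' Y W - (a * S u X' Y W + S v X' Y W).
  apply: (symmetric_form_eq0 g_nondeg (b := b)) => [W' c y z|y z|y hy]; rewrite /b.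
  - by rewrite !l3; ring.
  - by rewrite !(s34 _ _ y z).
  - by rewrite !(SK _ _ _ hy) K_form_linear_l subrr.
(* Compatibility enters here, exchanging the roles of the two pairs on the diagonal. *)
have SKY X X' Y (hY : nonnull g Y) : S Y Y X X' = g (K Y hY X) X'.
  apply/eqP; rewrite -subr_eq0; apply/eqP.
  pose b X X' := S Y Y X X' - g (K Y hY X) X'.
  apply: (symmetric_form_eq0 g_nondeg (b := b)) => [W' c y z|y z|y hy]; rewrite /b.
  - by rewrite l3 K_form_linear_l; ring.
  - by rewrite s34 K_form_sym.
  - by rewrite (SK _ _ _ hy) (K_compatible _ hY) subrr.
have pair X X' Y W : S X X' Y W = S Y W X X'.
  apply/eqP; rewrite -subr_eq0; apply/eqP.
  pose b Y W := S X X' Y W - S Y W X X'.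
  apply: (symmetric_form_eq0 g_nondeg (b := b)) => [W' c y z|y z|y hy]; rewrite /b.
  - by rewrite l3 l1; ring.
  - by rewrite (s34 _ _ y z) (s12 y z).
  - by rewrite (SK _ _ _ hy) (SKY _ _ _ hy) subrr.
(* On nonnull [X] this is [K_diag]; the cubic form argument extends it to all [X]. *)
have S0 X W : S X X X W = 0.
  apply: (cubic_form_eq0 g_nondeg (c := fun X Y Z => S X Y Z W))
    => [Y Z|Y Z|Y Z|Y hY].
  - exact: l1.
  - by move=> a u v; rewrite !(s12 Y) l1.
  - exact: l3.
  - by rewrite (SKY _ _ _ hY) K_diag linear0l.
exists (curvature_of_symmetric S); split.
  exact: curvature_of_symmetricP.
by move=> X Y W hX; rewrite curvature_of_symmetricE ?SKY.
Qed.

End JacobiFamily.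

Theorem theorem1 (R : realType) (V : vectType R) (g : {symmetric V})
  (g_nondeg : nondegenerate g)
  (K : forall X : V, nonnull g X -> 'End(V))
  (K_self_adjoint : forall (X : V) (hX : nonnull g X), self_adjoint g (K X hX))
  (K_compatible : forall (X Y : V) (hX : nonnull g X) (hY : nonnull g Y),
     g (K X hX Y) Y = g (K Y hY X) X)
  (K_diag : forall (X : V) (hX : nonnull g X), K X hX X = 0) :
  exists! T : V -> V -> V -> V -> R,
    algebraic_curvature_tensor T /\
    (forall (X : V) (hX : nonnull g X), jacobi_operator g T X =1 K X hX).
Proof.
have [T [hT TK]] := K_curvature_tensor g_nondeg K_self_adjoint
  K_compatible K_diag.
exists T; split.
  split; first exact: hT.
  move=> X hX Y; apply: (curvature_operator_unique g_nondeg) => W.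
  by rewrite (TK _ _ _ hX).
move=> T' [hT' T'K]; apply/funext => X; apply/funext => Y.
apply/funext => Z; apply/funext => W.
move: X Y Z W; apply: curvature_tensor_ext => // X Y W.
apply/eqP; rewrite -subr_eq0; apply/eqP.
(* The Jacobi operators are prescribed at nonnull [X] only. Symmetrizing in the two middle arguments
   gives a form whose diagonal is twice the difference to be killed. *)
pose b X X' := T Y X X' W + T Y X' X W - (T' Y X X' W + T' Y X' X W).
have : b X X = 0; last by rewrite /b; lra.
apply: (symmetric_form_eq0 g_nondeg (b := b)) => [z a u v|u v|u hu]; rewrite /b.
- rewrite (act_linear2 hT) (act_linear2 hT') (act_linear3 hT) (act_linear3 hT').
  by ring.
- by ring.
- rewrite (TK _ _ _ hu) -(T'K _ hu) jacobi_operatorE //; ring.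
Qed.
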